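(* Let $\mathcal X\subset\mathbb R^d$ be bounded and satisfy an interior cone condition. Let $k\in\mathbb N$, $s>0$, $\tau:=k+s>d/2$, $1\le q\le\infty$, and let $m\in\mathbb N_0$ with $m\le\lceil m_0\rceil-1$, where $m_0:=k+s-d\left(\tfrac12-\tfrac1q\right)_+$. Put $\gamma:=\max(2,q)$. Let $C,h_0>0$ be constants such that for all finite $\mathcal X_n\subset\mathcal X$ with $h_{\mathcal X_n,\mathcal X}\le h_0$ and all $z\in W_2^\tau(\mathcal X)$ the sampling inequality $$|z|_{W_q^m(\mathcal X)}\le C\left(h_{\mathcal X_n,\mathcal X}^{\tau-m-d(\frac12-\frac1q)_+}|z|_{W_2^\tau(\mathcal X)}+h_{\mathcal X_n,\mathcal X}^{\frac d\gamma-m}\|z_{|\mathcal X_n}\|_2\right)$$ holds (such constants exist by a known theorem of Arcangéli, López de Silanes and Torrens). Assume that $\mathcal H_K(\mathcal X)\hookrightarrow W_2^\tau(\mathcal X)$ continuously, i.e. there is $C_e>0$ with $|g|_{W_2^\tau(\mathcal X)}\le\|g\|_{W_2^\tau(\mathcal X)}\le C_e\|g\|_{\mathcal H_K(\mathcal X)}$ for all $g\in\mathcal H_K(\mathcal X)$. Let $\mathcal X_n=\{x_1,\dots,x_n\}\subset\mathcal X$ with $h_{\mathcal X_n,\mathcal X}\le h_0$, let $g\in\mathcal H_K(\mathcal X)$, $\lambda>0$, and let $\hat g^{(n)}_{s_\lambda}$ be computed from the noise-free samples $y=g_{|\mathcal X_n}$ by spectral regularization with a regularization function $s_\lambda$ with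 constants $D,C_{1/2}>0$. Then $$|g-\hat g^{(n)}_{s_\lambda}|_{W_q^m(\mathcal X)}\le C'\,h_{\mathcal X_n,\mathcal X}^{\frac d\gamma-m}\left(h_{\mathcal X_n,\mathcal X}^{\tau-\frac d2}+\lambda^{\frac12}\right)\|g\|_{\mathcal H_K},$$ where $C':=C\max\{C_e(D+1),C_{1/2}\}$.
   Context: Notation: $(x)_+:=\max(x,0)$, $x/\infty:=0$. The fill distance of $\mathcal X_n$ in $\mathcal X$ is $h_{\mathcal X_n,\mathcal X}:=\sup_{x\in\mathcal X}\min_{x_i\in\mathcal X_n}\|x-x_i\|_2$. $z_{|\mathcal X_n}=(z(x_1),\dots,z(x_n))\in\mathbb R^n$ and $\|\cdot\|_2$ is the Euclidean norm. Sobolev spaces: for integer $k$, $|g|_{W_p^k(\mathcal X)}=(\sum_{|\alpha|=k}\|D^\alpha g\|^p_{L_p(\mathcal X)})^{1/p}$ and $\|g\|_{W_p^k(\mathcal X)}=(\sum_{|\alpha|\le k}\|D^\alpha g\|^p_{L_p(\mathcal X)})^{1/p}$; for fractional order $k+s$ with $0<s<1$, $|g|_{W_p^{k+s}(\mathcal X)}=\big(\sum_{|\alpha|=k}\int_{\mathcal X\times\mathcal X}\frac{|D^\alpha g(x)-D^\alpha g(y)|^p}{\|x-y\|_2^{d+ps}}\,dx\,dy\big)^{1/p}$ and $\|g\|_{W_p^{k+s}}=(\|g\|^p_{W_p^k}+|g|^p_{W_p^{k+s}})^{1/p}$, with the usual modification for $p=\infty$. $\mathcal H_K=\mathcal H_K(\mathcal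 X)$ is a reproducing kernel Hilbert space of real functions on $\mathcal X$ with reproducing kernel $K$. (In the paper it is the range of a compact operator $A:\mathcal H_1\to\mathcal H_2$ of the form $(Aw)(x)=\langle w,\phi_x\rangle_{\mathcal H_1}$, with $K(x,x')=\langle\phi_x,\phi_{x'}\rangle_{\mathcal H_1}$.) Let $\mathsf K=(K(x_i,x_j))_{i,j=1}^n$ be the kernel matrix. Regularization function: $s_\lambda:[0,\infty)\to\mathbb R$, $\lambda>0$, is a family such that, with $I=[0,\|\mathsf K\|]$ ($\|\cdot\|$ the spectral norm): (1) $\sup_{t\in I}|t\,s_\lambda(t)|\le D$ uniformly in $\lambda>0$; (2) $\sup_{\lambda>0}\sup_{t\in I}|\lambda s_\lambda(t)|\le E$; (3) there is a qualification $q_s>0$ (here $q_s\ge 1/2$, so that $C_{1/2}$ exists) and constants $C_a>0$ with $\sup_{t\in I}|t^a(1-t s_\lambda(t))|\le C_a\lambda^a$ for all $\lambda>0$ and $0\le a\le q_s$. Spectrally regularized approximant: $\hat g^{(n)}_{s_\lambda}:=\sum_{i=1}^n(\alpha_\lambda)_iK(\cdot,x_i)$ with $\alpha_\lambda:=s_\lambda(\mathsf K)\,g_{|\mathcal X_n}$, where $s_\lambda(\mathsf K)$ is defined by spectral calculus. *)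

(* Defs.v *)
From HB Require Import structures.
From mathcomp Require Import all_boot all_order all_algebra.
From mathcomp Require Import all_classical all_reals all_analysis.

Set Implicit Arguments.
Unset Strict Implicit.
Unset Printing Implicit Defensive.

Import Order.TTheory GRing.Theory Num.Theory.
Import numFieldTopology.Exports numFieldNormedType.Exports.

Local Open Scope classical_set_scope.
Local Open Scope ring_scope.

(* The norm carried by ['rV[R]_d] in the library is the sup norm; it induces
   the same topology and the same bounded sets as the Euclidean norm [norm2],
   which is used for every metric quantity below. *)
Definition norm2 (R : realType) (n : nat) (v : 'I_n -> R) : R :=
  Num.sqrt (\sum_i v i ^+ 2).

Definition dist2 (R : realType) (d : nat) (x y : 'rV[R]_d) : R :=
  norm2 (fun i => x ord0 i - y ord0 i).

(* Every point of X is the vertex of a closed cone of fixed angle theta and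
   fixed radius r that is contained in X. *)
Definition interior_cone (R : realType) (d : nat) (X : set 'rV[R]_d) : Prop :=
  exists theta r : R, [/\ 0 < theta < pi / 2, 0 < r &
    forall x, X x -> exists2 xi : 'rV[R]_d, norm2 (xi ord0) = 1 &
      forall (y : 'rV[R]_d) (t : R), norm2 (y ord0) = 1 ->
        cos theta <= \sum_i y ord0 i * xi ord0 i ->
        0 <= t <= r -> X (x + t *: y)].

(* An empty family has fill distance +oo in a nonempty X. *)
Definition fill_distance (R : realType) (d n : nat) (X : set 'rV[R]_d)
    (xs : 'I_n -> 'rV[R]_d) : \bar R :=
  ereal_sup [set \big[mine/+oo%E]_(i < n) (dist2 x (xs i))%:E | x in X].


(* R^n is given the sigma-algebra generated by the coordinates, i.e. the Borel
   sigma-algebra. *)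
Section lebesgue_rV.
Variable R : realType.

Section measurable_rV.
Variable n : nat.

Definition coord_rV (i : 'I_n) (v : 'rV[R]_n) : measurableTypeR R := v ord0 i.

HB.instance Definition _ := @isMeasurable.Build
  (measure_tuple_display (R.-ocitv.-measurable).-sigma)
  'rV[R]_n (g_sigma_preimage coord_rV)
  (@sigma_algebra0 _ _ _) (@sigma_algebraC _ _) (@sigma_algebra_bigcup _ _ _).

Lemma measurable_coord_rV (i : 'I_n) : measurable_fun setT (coord_rV i).
Proof.
move=> _ Y mY; rewrite setTI; apply: sub_sigma_algebra => /=.
rewrite -bigcup_seq/=; exists i => /=; first by rewrite mem_index_enum.
by exists Y => //; rewrite setTI.
Qed.

Lemma measurable_fun_rV d (T : measurableType d) (f : T -> 'rV[R]_n) :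
  (forall i, measurable_fun setT (coord_rV i \o f)) -> measurable_fun setT f.
Proof.
move=> mf _ A mA; rewrite setTI.
have prefS : g_sigma_preimage (fun i => coord_rV i \o f) `<=` measurable.
  apply: smallest_sub; first exact: sigma_algebra_measurable.
  move=> B; rewrite -bigcup_seq => -[i _ [C mC <-]].
  exact: mf.
by apply: prefS; rewrite g_sigma_preimage_comp; exists A => //; rewrite setTI.
Qed.

End measurable_rV.

Definition cons_rV n (p : measurableTypeR R * 'rV[R]_n) : 'rV[R]_n.+1 :=
  \row_i (if unlift ord0 i is Some j then p.2 ord0 j else p.1).

Definition uncons_rV n (v : 'rV[R]_n.+1) : measurableTypeR R * 'rV[R]_n :=
  (v ord0 ord0, \row_j v ord0 (lift ord0 j)).

Lemma cons_rV0 n p : @cons_rV n p ord0 ord0 = p.1.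
Proof. by rewrite mxE unlift_none. Qed.

Lemma cons_rVS n p j : @cons_rV n p ord0 (lift ord0 j) = p.2 ord0 j.
Proof. by rewrite mxE liftK. Qed.

Lemma cons_rVK n : cancel (@cons_rV n) (@uncons_rV n).
Proof.
move=> [a v]; rewrite /uncons_rV cons_rV0; congr pair.
by apply/rowP => j; rewrite mxE cons_rVS.
Qed.

Lemma measurable_cons_rV n : measurable_fun setT (@cons_rV n).
Proof.
apply: measurable_fun_rV => i; case: (unliftP ord0 i) => [j|] ->.
  rewrite (_ : _ \o _ = coord_rV j \o snd); last first.
    by apply/funext => p; rewrite /= /coord_rV cons_rVS.
  exact: measurableT_comp (measurable_coord_rV j) measurable_snd.
rewrite (_ : _ \o _ = fst); last first.
  by apply/funext => p; rewrite /= /coord_rV cons_rV0.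
exact: measurable_fst.
Qed.

Lemma measurable_uncons_rV n : measurable_fun setT (@uncons_rV n).
Proof.
apply/measurable_fun_pairP; split; first exact: (measurable_coord_rV ord0).
apply: measurable_fun_rV => i.
rewrite (_ : _ \o _ = coord_rV (lift ord0 i)); first exact: measurable_coord_rV.
by apply/funext => v; rewrite /= /coord_rV mxE.
Qed.

Section lebesgue_cons.
Variables (n : nat) (mu : {sigma_finite_measure set 'rV[R]_n -> \bar R}).

Definition lebesgue_cons : set 'rV[R]_n.+1 -> \bar R :=
  pushforward (@lebesgue_measure R \x mu)%E (@cons_rV n).

Let lebesgue_cons0 : lebesgue_cons set0 = 0%E.
Proof. by rewrite /lebesgue_cons /pushforward preimage_set0 measure0. Qed.

Let lebesgue_cons_ge0 A : (0 <= lebesgue_cons A)%E.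
Proof. by rewrite /lebesgue_cons /pushforward measure_ge0. Qed.

Let lebesgue_cons_sigma_additive : semi_sigma_additive lebesgue_cons.
Proof.
move=> F mF tF mUF; rewrite /lebesgue_cons /pushforward preimage_bigcup.
apply: measure_semi_sigma_additive.
- by move=> k; rewrite -[X in measurable X]setTI; exact: measurable_cons_rV.
- apply/trivIsetP => /= i j _ _ ij; rewrite -preimage_setI.
  by move/trivIsetP : tF => /(_ _ _ _ _ ij) ->//; rewrite preimage_set0.
- rewrite -preimage_bigcup -[X in measurable X]setTI.
  exact: measurable_cons_rV.
Qed.

HB.instance Definition _ := isMeasure.Build _ _ _ lebesgue_cons
  lebesgue_cons0 lebesgue_cons_ge0 lebesgue_cons_sigma_additive.

Let lebesgue_cons_sigma_finite : sigma_finite setT lebesgue_cons.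
Proof.
have /sigma_finiteP[F [TF ndF Foo]] := sigma_finiteT (@lebesgue_measure R).
have /sigma_finiteP[G [TG ndG Goo]] := sigma_finiteT mu.
exists (fun k => @uncons_rV n @^-1` (F k `*` G k)).
  rewrite -preimage_bigcup predeqE => v; split => // _; rewrite /preimage/=.
  have [k _ Fk] : (\bigcup_k F k) (uncons_rV v).1 by rewrite -TF.
  have [l _ Gl] : (\bigcup_k G k) (uncons_rV v).2 by rewrite -TG.
  exists (maxn k l) => //; split; [move: Fk|move: Gl].
    exact/subsetPset/ndF/leq_maxl.
  exact/subsetPset/ndG/leq_maxr.
move=> k; have [mF Fk] := Foo k; have [mG Gk] := Goo k; split.
  rewrite -[X in measurable X]setTI; apply: measurable_uncons_rV => //.
  exact: measurableX.
rewrite /lebesgue_cons /pushforward -comp_preimage.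
rewrite (_ : _ \o _ = id); last by apply/funext => p /=; rewrite cons_rVK.
by rewrite preimage_id product_measure1E// lte_mul_pinfty// ge0_fin_numE.
Qed.

HB.instance Definition _ := Measure_isSigmaFinite.Build _ _ _ lebesgue_cons
  lebesgue_cons_sigma_finite.

End lebesgue_cons.

(* Lebesgue measure on R^n, as the n-fold product of the one-dimensional one. *)
Fixpoint lebesgue_rV (n : nat) :
    {sigma_finite_measure set 'rV[R]_n -> \bar R} :=
  if n is n'.+1 then lebesgue_cons (lebesgue_rV n') else dirac (0 : 'rV[R]_0).

End lebesgue_rV.

Section sobolev.
Variables (R : realType) (d : nat).
Local Notation E := 'rV[R]_d.
Local Notation leb := (lebesgue_rV R d).
Implicit Types (X Omega : set E) (u v f phi : E -> R).

Definition partial (i : 'I_d) f : E -> R := fun x => 'D_(delta_mx ord0 i) f x.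

(* Entries at most k suffice for the multi-indices of order at most k. *)
Definition multi_index (k : nat) := {ffun 'I_d -> 'I_k.+1}.

Definition multi_partial k (alpha : multi_index k) f : E -> R :=
  foldr (fun i g => iter (alpha i) (partial i) g) f (enum 'I_d).

Definition smooth f : Prop :=
  forall (s : seq 'I_d) (g := foldr partial f s),
    continuous g /\ forall (i : 'I_d) (x : E), derivable g x (delta_mx ord0 i).

Definition test_function Omega phi : Prop :=
  smooth phi /\ exists K : set E,
    [/\ compact K, K `<=` Omega & forall x, ~ K x -> phi x = 0].

Definition locally_integrable Omega u : Prop :=
  forall K : set E, compact K -> K `<=` Omega ->
    leb.-integrable K (EFin \o u).

Definition multi_order k (alpha : multi_index k) : nat := (\sum_i alpha i)%N.

(* The versions on Omega of the weak derivative D^alpha u. *)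
Definition weak_derivatives Omega k (alpha : multi_index k) u : set (E -> R) :=
  [set v | [/\ locally_integrable Omega u, locally_integrable Omega v &
    forall phi, test_function Omega phi ->
      \int[leb]_(x in Omega) (u x * multi_partial alpha phi x) =
      (-1) ^+ multi_order alpha * \int[leb]_(x in Omega) (v x * phi x)]].

(* Two versions of a weak derivative agree almost everywhere on Omega. Hence,
   for an F that only depends on the a.e. class, the infimum is F (D^alpha u)
   if u has a weak derivative D^alpha u, and +oo otherwise. *)
Definition at_weak_derivative Omega k (alpha : multi_index k) u
    (F : (E -> R) -> \bar R) : \bar R :=
  ereal_inf (F @` weak_derivatives Omega alpha u).

Definition Lp_norm Omega (p : \bar R) v : \bar R :=
  Lnorm leb p ((EFin \o v) \_ Omega).

Definition gagliardo Omega (p : \bar R) (s : R) v : \bar R :=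
  if p is r%:E then
    ((\int[leb \x leb]_(z in Omega `*` Omega)
       (`|v z.1 - v z.2| `^ r / dist2 z.1 z.2 `^ (d%:R + r * s))%:E) `^ r^-1)%E
  else Lnorm (leb \x leb)%E +oo%E
    ((fun z => (`|v z.1 - v z.2| / dist2 z.1 z.2 `^ s)%:E)
       \_ (Omega `*` Omega)).

Definition lp_sum (I : finType) (P : pred I) (p : \bar R) (a : I -> \bar R) :
    \bar R :=
  if p is r%:E then ((\sum_(i | P i) a i `^ r) `^ r^-1)%E
  else \big[maxe/0%E]_(i | P i) a i.

Definition int_seminorm Omega (p : \bar R) (k : nat) u : \bar R :=
  lp_sum (fun alpha : multi_index k => multi_order alpha == k) p
    (fun alpha => at_weak_derivative Omega alpha u (Lp_norm Omega p)).

Definition int_norm Omega (p : \bar R) (k : nat) u : \bar R :=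
  lp_sum (fun alpha : multi_index k => (multi_order alpha <= k)%N) p
    (fun alpha => at_weak_derivative Omega alpha u (Lp_norm Omega p)).

Definition frac_seminorm Omega (p : \bar R) (k : nat) (s : R) u : \bar R :=
  lp_sum (fun alpha : multi_index k => multi_order alpha == k) p
    (fun alpha => at_weak_derivative Omega alpha u (gagliardo Omega p s)).

(* Sobolev seminorm and norm of real order t >= 0, split as t = k + s with k an
   integer and 0 <= s < 1. Both are +oo when a required weak derivative does
   not exist. The set X need not be open: derivatives and integrals are taken on
   its interior. If X satisfies an interior cone condition, then X is contained
   in the closure of its interior and the boundary of X is Lebesgue-null (none
   of its points is one of its Lebesgue density points), so that integrals over
   X and over its interior agree. *)
Definition sobolev_seminorm X (p : \bar R) (t : R) u : \bar R :=
  let k := Num.truncn t in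
  let s := t - k%:R in
  if s == 0 then int_seminorm X° p k u else frac_seminorm X° p k s u.

Definition sobolev_norm X (p : \bar R) (t : R) u : \bar R :=
  let k := Num.truncn t in
  let s := t - k%:R in
  if s == 0 then int_norm X° p k u
  else lp_sum predT p (fun b : bool =>
    if b then int_norm X° p k u else frac_seminorm X° p k s u).

(* For t > d / p a class in W_p^t has a continuous representative, and it is
   this representative whose point values are sampled. *)
Definition continuous_sobolev X (p : \bar R) (t : R) : set (E -> R) :=
  [set u | {within X, continuous u} /\ (sobolev_norm X p t u < +oo)%E].

(* A reproducing kernel Hilbert space of real functions on X with kernel K:
   a Hilbert space identified, through the injective linear map rkhs_fun, with a
   space of functions on X. Values of rkhs_fun and of K at points outside X are
   irrelevant. *)
Record rkhs X (K : E -> E -> R) := Rkhs {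
  rkhs_space :> completeNormedModType R ;
  rkhs_ip : rkhs_space -> rkhs_space -> R ;
  rkhs_fun : rkhs_space -> E -> R ;
  rkhs_ipC : forall f g : rkhs_space, rkhs_ip f g = rkhs_ip g f ;
  rkhs_ip_linear : forall (a : R) (f g h : rkhs_space),
    rkhs_ip (a *: f + g) h = a * rkhs_ip f h + rkhs_ip g h ;
  rkhs_ip_norm : forall f : rkhs_space, rkhs_ip f f = `|f| ^+ 2 ;
  rkhs_fun_linear : forall (a : R) (f g : rkhs_space) x, X x ->
    rkhs_fun (a *: f + g) x = a * rkhs_fun f x + rkhs_fun g x ;
  rkhs_fun_inj : forall f g : rkhs_space,
    (forall x, X x -> rkhs_fun f x = rkhs_fun g x) -> f = g ;
  rkhs_reproducing : forall y, X y -> exists2 Ky : rkhs_space,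
    (forall x, X x -> rkhs_fun Ky x = K x y) &
    (forall f : rkhs_space, rkhs_ip f Ky = rkhs_fun f y)
}.

End sobolev.

Section spectral.
Variables (R : realType) (n : nat).
Implicit Types (A P : 'M[R]_n) (l : 'rV[R]_n).

Definition spectral_norm A : R :=
  sup [set norm2 (fun i => (A *m v) i ord0) |
        v in [set v : 'cV[R]_n | norm2 (fun i => v i ord0) <= 1]].

Definition orthogonal_diagonalization A P l : Prop :=
  P *m P^T = 1%:M /\ A = P^T *m diag_mx l *m P.

(* f(A) for a real symmetric A; it does not depend on the diagonalization. *)
Definition spectral_calculus (f : R -> R) A : 'M[R]_n :=
  xget 0 [set B | exists P l, orthogonal_diagonalization A P l /\
    B = P^T *m diag_mx (map_mx f l) *m P].

End spectral.

(* M is the right end point of the interval I = [0, M]; only the values of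
   reg lambda on [0, +oo) are meaningful. *)
Record regularization (R : realType) (M : R) (reg : R -> R -> R)
    (D E qs : R) (Ca : R -> R) : Prop := {
  reg_bound : forall lambda t, 0 < lambda -> 0 <= t <= M ->
    `|t * reg lambda t| <= D ;
  reg_growth : forall lambda t, 0 < lambda -> 0 <= t <= M ->
    `|lambda * reg lambda t| <= E ;
  reg_qualification_gt0 : 0 < qs ;
  reg_const_gt0 : forall a, 0 <= a <= qs -> 0 < Ca a ;
  reg_residual : forall a lambda t, 0 <= a <= qs -> 0 < lambda ->
    0 <= t <= M -> `|t `^ a * (1 - t * reg lambda t)| <= Ca a * lambda `^ a
}.

Section approximant.
Variables (R : realType) (d n : nat) (K : 'rV[R]_d -> 'rV[R]_d -> R).
Variable xs : 'I_n -> 'rV[R]_d.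

Definition kernel_matrix : 'M[R]_n := \matrix_(i, j) K (xs i) (xs j).

Definition reg_coef (reg : R -> R -> R) (lambda : R) (y : 'I_n -> R) :
    'cV[R]_n :=
  spectral_calculus (reg lambda) kernel_matrix *m \col_i y i.

Definition reg_approx (reg : R -> R -> R) (lambda : R) (y : 'I_n -> R)
    (x : 'rV[R]_d) : R :=
  \sum_i reg_coef reg lambda y i ord0 * K x (xs i).

End approximant.

(* Main.v *)
Require Import Defs.
From HB Require Import structures.
From mathcomp Require Import all_boot all_order all_algebra.
From mathcomp Require Import all_classical all_reals all_analysis.
From mathcomp Require Import complex spectral.
From mathcomp Require Import ring lra.
Import Order.TTheory GRing.Theory Num.Theory.
Import numFieldTopology.Exports numFieldNormedType.Exports.
Local Open Scope classical_set_scope.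
Local Open Scope ring_scope.

(** Write w for the approximant of g, f := g - w, and let k_i be the
    representer of evaluation at x_i, so that w is a combination of the k_i.
    The sampling inequality is applied to z = f, and it remains to bound its
    two right-hand terms by multiples of the RKHS norm of g.

    Both bounds come from diagonalizing the kernel matrix, the Gram matrix of
    the k_i, as P^T diag(l) P with P orthogonal.  The vectors
    e_j = sum_i P_ji k_i are then orthogonal in the RKHS with |e_j|^2 = l_j,
    and the j-th coordinate of P g_{|X_n} is c_j = <g, e_j>.  In these
    coordinates spectral regularization acts diagonally:
    w = sum_j s(l_j) c_j e_j, hence
      |w|^2 = sum_j (l_j s(l_j))^2 c_j^2 / l_j,
      |f_{|X_n}|_2^2 = sum_j l_j (1 - l_j s(l_j))^2 c_j^2 / l_j.
    Each filter factor is bounded by hypothesis, by D^2 and by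
    C_{1/2}^2 lambda, because every l_j lies in [0, ||K||]; and
    sum_j c_j^2 / l_j <= |g|^2 is Bessel's inequality
    ([bessel], [spectral_filter_bounds]).  An index with l_j = 0 contributes
    nothing, since then e_j = 0 and c_j = 0.

    The first bound and the embedding control the Sobolev seminorm of f of
    order tau by C_e (D + 1) |g|.  Finally
    (1/2 - 1/q)_+ = 1/2 - 1/max(2, q) ([fine_inv_maxe2]), so the power of h
    in front of that seminorm is h^(d/gamma - m) h^(tau - d/2).

    The diagonalization itself ([symmetric_diagonalization]) is the real
    spectral theorem: a complex eigenvector of a real symmetric matrix yields
    a real one, a Householder reflection moves it to the first basis vector,
    and induction handles the complementary block. *)

Set Implicit Arguments.
Unset Strict Implicit.

(** * Diagonalization of real symmetric matrices *)

Lemma row_sqnormE (R : comPzRingType) (n : nat) (u : 'rV[R]_n) :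
  (u *m u^T) ord0 ord0 = \sum_i u ord0 i ^+ 2.
Proof. by rewrite mxE; apply: eq_bigr => i _; rewrite mxE expr2. Qed.

Lemma row_sqnorm_ge0 (R : realDomainType) (n : nat) (u : 'rV[R]_n) :
  0 <= (u *m u^T) ord0 ord0.
Proof. by rewrite row_sqnormE sumr_ge0// => i _; exact: sqr_ge0. Qed.

Lemma row_sqnorm_eq0 (R : realDomainType) (n : nat) (u : 'rV[R]_n) :
  ((u *m u^T) ord0 ord0 == 0) = (u == 0).
Proof.
apply/idP/eqP => [|->]; last by rewrite mul0mx mxE.
rewrite row_sqnormE psumr_eq0 => [/allP u0|i _]; last exact: sqr_ge0.
apply/rowP => i; rewrite mxE; apply/eqP; rewrite -sqrf_eq0.
by have := u0 i; rewrite mem_index_enum; apply.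
Qed.

(** An eigenvalue z = a + i b with eigenvector x + i y exists over the complex
    numbers. Symmetry of A forces b (|x|^2 + |y|^2) = 0, so z is real, and the
    nonzero one among x and y is a real eigenvector. *)
Lemma symmetric_eigenvector (R : rcfType) (n : nat) (A : 'M[R]_n) :
  (0 < n)%N -> A^T = A ->
  exists a, exists2 v : 'rV[R]_n, v != 0 & v *m A = a *: v.
Proof.
move=> n_gt0 symA.
pose toC : {rmorphism R -> complex R} := real_complex R.
have [z] := eigenvalue_closed (map_mx toC A) n_gt0.
move=> /eigenvalueP[v vA v_neq0].
pose x : 'rV[R]_n := map_mx (@complex.Re R) v.
pose y : 'rV[R]_n := map_mx (@complex.Im R) v.
pose a := complex.Re z; pose b := complex.Im z.
have ReM w (r : R) : complex.Re (w * toC r) = complex.Re w * r.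
  by case: w => p q /=; rewrite mulr0 subr0.
have ImM w (r : R) : complex.Im (w * toC r) = complex.Im w * r.
  by case: w => p q /=; rewrite mulr0 add0r.
have xA : x *m A = a *: x - b *: y.
  apply/rowP => j; have /rowP/(_ j) := vA.
  rewrite !mxE => /(congr1 (@complex.Re R)).
  rewrite raddf_sum/= => vAj.
  transitivity (complex.Re (z * v ord0 j)); first last.
    by rewrite /a /b; case: (z) (v ord0 j) => [? ?] [? ?].
  by rewrite -vAj; apply: eq_bigr => i _; rewrite !mxE ReM.
have yA : y *m A = a *: y + b *: x.
  apply/rowP => j; have /rowP/(_ j) := vA.
  rewrite !mxE => /(congr1 (@complex.Im R)).
  rewrite raddf_sum/= => vAj.
  transitivity (complex.Im (z * v ord0 j)); first last.
    by rewrite /a /b; case: (z) (v ord0 j) => [? ?] [? ?].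
  by rewrite -vAj; apply: eq_bigr => i _; rewrite !mxE ImM.
have xy_neq0 : (x != 0) || (y != 0).
  rewrite -negb_and; apply: contra v_neq0 => /andP[/eqP x0 /eqP y0].
  apply/eqP/rowP => j; rewrite mxE.
  have := congr1 (fun u : 'rV[R]_n => u ord0 j) x0.
  have := congr1 (fun u : 'rV[R]_n => u ord0 j) y0.
  by rewrite !mxE; case: (v ord0 j) => ? ? /= -> ->.
(* x A y^T is computed in two ways, A acting to the left or to the right. *)
have b0 : b = 0.
  have : (x *m A) *m y^T = x *m (y *m A)^T.
    by rewrite trmx_mul symA mulmxA.
  rewrite xA yA [(_ + _)^T]linearD/= ![(_ *: _)^T]linearZ/=.
  rewrite mulmxBl mulmxDr -!scalemxAl -!scalemxAr.
  move=> /(congr1 (fun u : 'M[R]_1 => u ord0 ord0)); rewrite !mxE => e.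
  have /eqP : b * ((x *m x^T) ord0 ord0 + (y *m y^T) ord0 ord0) = 0.
    by rewrite !mxE; lra.
  rewrite mulf_eq0 => /orP[/eqP//|].
  rewrite paddr_eq0 ?row_sqnorm_ge0// !row_sqnorm_eq0 -[_ && _]negbK negb_and.
  by rewrite xy_neq0.
move: xA yA; rewrite b0 !scale0r subr0 addr0 => xA yA.
by case/orP: xy_neq0 => ?; exists a; [exists x|exists y].
Qed.

(** If v differs from e_0, the reflection in the hyperplane orthogonal to
    v - e_0 exchanges the unit vectors v and e_0; its first row is then v. *)
Lemma householder (R : rcfType) (n : nat) (v : 'rV[R]_n.+1) :
  v *m v^T = 1%:M ->
  exists2 Q : 'M[R]_n.+1, Q *m Q^T = 1%:M & row ord0 Q = v.
Proof.
move=> v_unit; pose e : 'rV[R]_n.+1 := delta_mx ord0 ord0.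
pose u : 'rV[R]_n.+1 := v - e.
have [u0|u_neq0] := eqVneq u 0.
  exists 1%:M; first by rewrite trmx1 mulmx1.
  by rewrite row1; apply/esym/eqP; rewrite -subr_eq0 -/e -/u u0.
pose c : R := (u *m u^T) ord0 ord0.
have c_neq0 : c != 0 by rewrite row_sqnorm_eq0.
have uuE : u *m u^T = c%:M by rewrite [LHS]mx11_scalar.
have eE (w : 'rV[R]_n.+1) : e *m w^T = (w ord0 ord0)%:M.
  by rewrite [LHS]mx11_scalar -rowE !mxE.
have cE : c = 2 * (1 - v ord0 ord0).
  rewrite /c (_ : u^T = v^T - e^T); last by rewrite /u linearB.
  rewrite /u mulmxBl !mulmxBr v_unit !eE.
  rewrite -[v *m e^T]trmxK trmx_mul trmxK eE !mxE eqxx !mulr1n; ring.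
pose Q := 1%:M - (2 / c) *: (u^T *m u).
have QT : Q^T = Q.
  by rewrite /Q linearB/= linearZ/= trmx1 trmx_mul trmxK.
exists Q.
  have NN : (2 / c *: (u^T *m u)) *m (2 / c *: (u^T *m u)) =
      2 *: (2 / c *: (u^T *m u)).
    rewrite -scalemxAl -scalemxAr -mulmxA [u *m (_ *m _)]mulmxA uuE.
    by rewrite mul_scalar_mx -scalemxAr !scalerA; congr (_ *: _); field.
  move: NN; rewrite QT /Q; move: (2 / c *: _) => N NN.
  rewrite mulmxBl mul1mx mulmxBr mulmx1 NN scaler_nat mulr2n.
  by rewrite opprB addrK subrK.
rewrite rowE -/e /Q mulmxBr mulmx1 -scalemxAr mulmxA eE mul_scalar_mx scalerA.
have -> : 2 / c * u ord0 ord0 = -1.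
  rewrite /u !mxE !eqxx mulr1n -[v _ _ - 1]opprB.
  by move: c_neq0; rewrite cE mulf_eq0 pnatr_eq0 => v_neq1; field.
by rewrite scaleN1r opprK addrC subrK.
Qed.

(** Conjugating A by an orthogonal matrix whose first row is an eigenvector
    splits off a 1 x 1 block; the other diagonal block is again symmetric. *)
Lemma symmetric_diagonalization (R : rcfType) (n : nat) (A : 'M[R]_n) :
  A^T = A -> exists P (l : 'rV[R]_n),
    P *m P^T = 1%:M /\ A = P^T *m diag_mx l *m P.
Proof.
elim: n A => [|n IHn] A symA.
  by exists 1%:M, 0; split; apply/matrixP => -[].
have [a [w w_neq0 wA]] := symmetric_eigenvector (ltn0Sn n) symA.
pose c : R := (w *m w^T) ord0 ord0.
have c_gt0 : 0 < c by rewrite lt_def row_sqnorm_eq0 w_neq0 row_sqnorm_ge0.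
pose v := (Num.sqrt c)^-1 *: w.
have vA : v *m A = a *: v.
  by rewrite /v -scalemxAl wA !scalerA mulrC.
have v_unit : v *m v^T = 1%:M.
  rewrite /v linearZ/= -scalemxAl -scalemxAr scalerA -invfM -expr2.
  rewrite sqr_sqrtr ?ltW// [w *m _]mx11_scalar -/c scale_scalar_mx mulVf//.
  by rewrite gt_eqF.
have [Q QQT rowQ] := householder v_unit.
have QTQ : Q^T *m Q = 1%:M by exact: mulmx1C.
pose B : 'M[R]_(1 + n) := Q *m A *m Q^T.
have symB : B^T = B by rewrite /B !trmx_mul trmxK symA mulmxA.
have rowB : row ord0 B = a *: delta_mx ord0 ord0.
  rewrite /B !row_mul rowQ vA -scalemxAl -rowQ -row_mul QQT.
  by rewrite rowE mulmx1.
have AB : A = Q^T *m B *m Q.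
  by rewrite /B !mulmxA QTQ mul1mx -mulmxA QTQ mulmx1.
(* B is made opaque so that mxE stops at its entries. *)
clearbody B; have Bij j : B ord0 j = a * (ord0 == j)%:R.
  by have /rowP/(_ j) := rowB; rewrite !mxE eqxx [ord0 == j]eq_sym.
have BE : B = block_mx a%:M 0 0 (drsubmx B).
  have -> : a%:M = ulsubmx B.
    by apply/matrixP => i j; rewrite !ord1 !mxE !lshift0 Bij mulr1.
  have row0 : ursubmx B = 0.
    by apply/matrixP => i j; rewrite !ord1 !mxE !lshift0 Bij mulr0.
  have col0 : dlsubmx B = 0 by rewrite -symB -trmx_ursub row0 trmx0.
  by rewrite -[LHS]submxK row0 col0.
have [P' [l' [PPT BPl]]] : exists P (l : 'rV[R]_n),
    P *m P^T = 1%:M /\ drsubmx B = P^T *m diag_mx l *m P.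
  by apply: IHn; rewrite -{2}symB trmx_drsub.
pose P : 'M[R]_(1 + n) := block_mx 1%:M 0 0 P'.
have PP : P *m P^T = 1%:M.
  rewrite /P tr_block_mx !trmx0 trmx1 mulmx_block !mulmx0 !mul0mx mulmx1.
  by rewrite !addr0 add0r PPT -scalar_mx_block.
have PBP : B = P^T *m diag_mx (row_mx a%:M l') *m P.
  rewrite {1}BE BPl /P tr_block_mx diag_mx_row !trmx0 trmx1 !mulmx_block.
  rewrite !mulmx0 !mul0mx !mul1mx !mulmx1 !addr0 !add0r.
  congr (block_mx _ _ _ _); last by rewrite mul0mx.
  by apply/matrixP => i j; rewrite !ord1 !mxE.
exists (P *m Q), (row_mx a%:M l'); split.
  by rewrite trmx_mul mulmxA -[P *m Q *m _]mulmxA QQT mulmx1.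
by rewrite {1}AB trmx_mul {1}PBP !mulmxA.
Qed.

(** * Eigenvalues, spectral norm and spectral calculus *)

Section diagonalization.
Variables (R : realType) (n : nat) (A P : 'M[R]_n) (l : 'rV[R]_n).
Hypothesis APl : orthogonal_diagonalization A P l.

Let PPT : P *m P^T = 1%:M. Proof. by case: APl. Qed.
Let PTP : P^T *m P = 1%:M. Proof. exact: mulmx1C. Qed.

Lemma orthogonal_sum_sqr (v : 'cV[R]_n) :
  \sum_j ((P *m v) j ord0) ^+ 2 = \sum_i (v i ord0) ^+ 2.
Proof.
have sqE (w : 'cV[R]_n) : \sum_i (w i ord0) ^+ 2 = (w^T *m w) ord0 ord0.
  by rewrite mxE; apply: eq_bigr => i _; rewrite mxE expr2.
by rewrite !sqE trmx_mul mulmxA -[_ *m P^T *m P]mulmxA PTP mulmx1.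
Qed.

Lemma orthogonal_norm2 (v : 'cV[R]_n) :
  norm2 (fun j => (P *m v) j ord0) = norm2 (fun i => v i ord0).
Proof. by rewrite /norm2 orthogonal_sum_sqr. Qed.

Lemma diagonalization_mul : P *m A = diag_mx l *m P.
Proof. by case: APl => _ ->; rewrite !mulmxA PPT mul1mx. Qed.

Lemma diagonalization_conj : P *m A *m P^T = diag_mx l.
Proof. by rewrite diagonalization_mul -mulmxA PPT mulmx1. Qed.

Lemma norm2_mulmx_le (M : R) (v : 'cV[R]_n) : 0 <= M ->
  (forall j, `|l ord0 j| <= M) ->
  norm2 (fun i => (A *m v) i ord0) <= M * norm2 (fun i => v i ord0).
Proof.
move=> M_ge0 lM; rewrite -(orthogonal_norm2 (A *m v)) -(orthogonal_norm2 v).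
rewrite mulmxA diagonalization_mul -mulmxA.
rewrite /norm2 -[X in X * _](ger0_norm M_ge0) -sqrtr_sqr -sqrtrM ?sqr_ge0//.
rewrite ler_wsqrtr// mulr_sumr ler_sum// => j _.
rewrite mul_diag_mx mxE exprMn ler_wpM2r ?sqr_ge0//.
by rewrite -[l _ _ ^+ 2]real_normK ?num_real// lerXn2r// nnegrE.
Qed.

(** The j-th column of P^T is a unit eigenvector, on which A acts with norm
    |l_j|; [norm2_mulmx_le] makes the supremum a genuine one. *)
Lemma eigenvalue_le_spectral_norm (j : 'I_n) : `|l ord0 j| <= spectral_norm A.
Proof.
pose v : 'cV[R]_n := P^T *m delta_mx j ord0.
have norm_delta (a : R) :
    norm2 (fun i => (a *: delta_mx j ord0 : 'cV[R]_n) i ord0) = `|a|.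
  rewrite /norm2 (bigD1 j)//= big1 => [|i ij]; rewrite !mxE.
    by rewrite addr0 !eqxx mulr1 sqrtr_sqr.
  by rewrite (negbTE ij) mulr0 expr0n.
have Pv : P *m v = delta_mx j ord0 by rewrite /v mulmxA PPT mul1mx.
apply: ub_le_sup; last first.
  exists v => /=.
    by rewrite -orthogonal_norm2 Pv -[delta_mx _ _]scale1r norm_delta normr1.
  rewrite -orthogonal_norm2 mulmxA diagonalization_mul -mulmxA Pv.
  rewrite (_ : _ *m _ = l ord0 j *: delta_mx j ord0) ?norm_delta//.
  apply/colP => i; rewrite mul_diag_mx !mxE.
  by case: eqP => [->|_]; rewrite ?mulr0.
exists (\sum_i `|l ord0 i|) => _ [w w_le1 <-].
apply: le_trans (norm2_mulmx_le (M := \sum_i `|l ord0 i|) _ _ _) _.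
- by rewrite sumr_ge0.
- by move=> i; rewrite (bigD1 i)//= lerDl sumr_ge0.
- by rewrite ler_piMr// sumr_ge0.
Qed.

End diagonalization.

(** The value of [spectral_calculus] is a choice among candidates, which form
    a nonempty set by [symmetric_diagonalization]. *)
Lemma spectral_calculusP (R : realType) (n : nat) (f : R -> R) (A : 'M[R]_n) :
  A^T = A -> exists P l, orthogonal_diagonalization A P l /\
    spectral_calculus f A = P^T *m diag_mx (map_mx f l) *m P.
Proof.
move=> /symmetric_diagonalization[P [l APl]].
pose S := [set B | exists P l, orthogonal_diagonalization A P l /\
    B = P^T *m diag_mx (map_mx f l) *m P].
suff : S (xget 0 S) by [].
by apply: xgetPex; exists (P^T *m diag_mx (map_mx f l) *m P), P, l.
Qed.

(** * Inner products in a reproducing kernel Hilbert space *)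

Section rkhs_theory.
Variables (R : realType) (d : nat) (X : set 'rV[R]_d).
Variables (K : 'rV[R]_d -> 'rV[R]_d -> R) (H : rkhs X K).
Implicit Types f g h : H.

Lemma rkhs_ipDl f g h : rkhs_ip (f + g) h = rkhs_ip f h + rkhs_ip g h.
Proof. by rewrite -[f]scale1r rkhs_ip_linear mul1r scale1r. Qed.

Lemma rkhs_ip0l h : rkhs_ip (0 : H) h = 0.
Proof. by apply: (@addrI _ (rkhs_ip (0 : H) h)); rewrite -rkhs_ipDl !addr0. Qed.

Lemma rkhs_ipZl a f h : rkhs_ip (a *: f) h = a * rkhs_ip f h.
Proof. by rewrite -[a *: f]addr0 rkhs_ip_linear rkhs_ip0l addr0. Qed.

Lemma rkhs_ip_suml (I : finType) (F : I -> H) h :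
  rkhs_ip (\sum_i F i) h = \sum_i rkhs_ip (F i) h.
Proof.
by apply: (big_morph (fun f => rkhs_ip f h)) => [f g|];
  [exact: rkhs_ipDl|exact: rkhs_ip0l].
Qed.

Lemma rkhs_ipBl f g h : rkhs_ip (f - g) h = rkhs_ip f h - rkhs_ip g h.
Proof. by rewrite rkhs_ipDl -scaleN1r rkhs_ipZl mulN1r. Qed.

Lemma rkhs_ip_sumr (I : finType) (F : I -> H) f :
  rkhs_ip f (\sum_i F i) = \sum_i rkhs_ip f (F i).
Proof.
by rewrite rkhs_ipC rkhs_ip_suml; apply: eq_bigr => i _; rewrite rkhs_ipC.
Qed.

Lemma rkhs_ipZr a f h : rkhs_ip f (a *: h) = a * rkhs_ip f h.
Proof. by rewrite rkhs_ipC rkhs_ipZl rkhs_ipC. Qed.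

Lemma rkhs_ipBr f g h : rkhs_ip h (f - g) = rkhs_ip h f - rkhs_ip h g.
Proof. by rewrite rkhs_ipC rkhs_ipBl !(rkhs_ipC h). Qed.

Lemma rkhs_ip_eq0 f : (rkhs_ip f f == 0) = (f == 0).
Proof. by rewrite rkhs_ip_norm sqrf_eq0 normr_eq0. Qed.

Lemma rkhs_fun_sum (n : nat) (a : 'I_n -> R) (k : 'I_n -> H) x : X x ->
  rkhs_fun (\sum_i a i *: k i) x = \sum_i a i * rkhs_fun (k i) x.
Proof.
move=> Xx; have [Kx _ evalE] := rkhs_reproducing H Xx.
by rewrite -evalE rkhs_ip_suml; apply: eq_bigr => i _; rewrite rkhs_ipZl evalE.
Qed.

Lemma rkhs_funB f g x : X x ->
  rkhs_fun (f - g) x = rkhs_fun f x - rkhs_fun g x.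
Proof.
move=> Xx; have [Kx _ evalE] := rkhs_reproducing H Xx.
by rewrite -!evalE rkhs_ipBl.
Qed.

(** Zero vectors are allowed in the family: an index with l i = 0 is harmless
    because the corresponding coefficients vanish ([orthogonal_null_coef]). *)
Section orthogonal_family.
Variables (n : nat) (e : 'I_n -> H) (l : 'I_n -> R).
Hypothesis e_orth : forall i j, rkhs_ip (e i) (e j) = (l i) *+ (i == j).

Lemma orthogonal_sqnorm_ge0 i : 0 <= l i.
Proof.
by have := e_orth i i; rewrite eqxx mulr1n rkhs_ip_norm => <-; exact: sqr_ge0.
Qed.

Lemma orthogonal_comb_ip (b : 'I_n -> R) j :
  rkhs_ip (\sum_i b i *: e i) (e j) = b j * l j.
Proof.
rewrite rkhs_ip_suml (bigD1 j)//= big1 => [|i ij]; rewrite rkhs_ipZl e_orth.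
  by rewrite eqxx addr0.
by rewrite (negbTE ij) mulr0.
Qed.

Lemma orthogonal_comb_sqnorm (b : 'I_n -> R) :
  `|\sum_i b i *: e i| ^+ 2 = \sum_j b j ^+ 2 * l j.
Proof.
rewrite -rkhs_ip_norm rkhs_ip_sumr; apply: eq_bigr => j _.
by rewrite rkhs_ipZr orthogonal_comb_ip expr2 mulrA.
Qed.

Lemma orthogonal_null_coef f j : l j = 0 -> rkhs_ip f (e j) = 0.
Proof.
move=> lj0; have /eqP : rkhs_ip (e j) (e j) = 0 by rewrite e_orth lj0 mul0rn.
by rewrite rkhs_ip_eq0 => /eqP ->; rewrite rkhs_ipC rkhs_ip0l.
Qed.

(** The squared norm of f minus its projection onto the span of the e_j is
    nonnegative. Inverting 0 gives 0, which drops the zero vectors. *)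
Lemma bessel f : \sum_j rkhs_ip f (e j) ^+ 2 / l j <= `|f| ^+ 2.
Proof.
pose b j := rkhs_ip f (e j) / l j; pose p := \sum_j b j *: e j.
have bl j : b j ^+ 2 * l j = rkhs_ip f (e j) ^+ 2 / l j.
  rewrite /b; have [lj0|lj_neq0] := eqVneq (l j) 0.
    by rewrite lj0 invr0 !mulr0.
  by field.
have fp : rkhs_ip f p = \sum_j rkhs_ip f (e j) ^+ 2 / l j.
  rewrite rkhs_ip_sumr; apply: eq_bigr => j _; rewrite rkhs_ipZr /b; ring.
have pp : rkhs_ip p p = \sum_j rkhs_ip f (e j) ^+ 2 / l j.
  rewrite rkhs_ip_norm orthogonal_comb_sqnorm.
  by apply: eq_bigr => j _; exact: bl.
have := sqr_ge0 `|f - p|.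
rewrite -(rkhs_ip_norm (f - p)) rkhs_ipBl !rkhs_ipBr [rkhs_ip p f]rkhs_ipC.
by rewrite fp pp subrr subr0 rkhs_ip_norm subr_ge0.
Qed.

End orthogonal_family.

(** * The kernel matrix and its principal vectors *)

Section sampling_points.
Variables (n : nat) (xs : 'I_n -> 'rV[R]_d).
Hypothesis xs_X : forall i, X (xs i).

Lemma rkhs_representers : exists2 k : 'I_n -> H,
  (forall i x, X x -> rkhs_fun (k i) x = K x (xs i)) &
  (forall i f, rkhs_ip f (k i) = rkhs_fun f (xs i)).
Proof.
have rep i : {k : H | (forall x, X x -> rkhs_fun k x = K x (xs i)) /\
    (forall f, rkhs_ip f k = rkhs_fun f (xs i))}.
  by apply: cid; have [k ? ?] := rkhs_reproducing H (xs_X i); exists k.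
exists (fun i => projT1 (rep i)) => i; by case: (projT2 (rep i)).
Qed.

Variable k : 'I_n -> H.
Hypothesis k_fun : forall i x, X x -> rkhs_fun (k i) x = K x (xs i).
Hypothesis k_ip : forall i f, rkhs_ip f (k i) = rkhs_fun f (xs i).

Lemma kernel_matrix_gram i j : kernel_matrix K xs i j = rkhs_ip (k i) (k j).
Proof. by rewrite mxE rkhs_ipC k_ip k_fun. Qed.

Lemma kernel_matrix_sym : (kernel_matrix K xs)^T = kernel_matrix K xs.
Proof. by apply/matrixP => i j; rewrite mxE !kernel_matrix_gram rkhs_ipC. Qed.

Variables (P : 'M[R]_n) (l : 'rV[R]_n).
Hypothesis KPl : orthogonal_diagonalization (kernel_matrix K xs) P l.

Let e (j : 'I_n) : H := \sum_i P j i *: k i.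

Lemma principal_ip f j :
  rkhs_ip f (e j) = (P *m \col_i rkhs_fun f (xs i)) j ord0.
Proof.
rewrite rkhs_ip_sumr mxE; apply: eq_bigr => i _.
by rewrite rkhs_ipZr k_ip mxE.
Qed.

(** Mixing the representers by P turns their Gram matrix, the kernel matrix,
    into diag(l). *)
Lemma principal_orth i j : rkhs_ip (e i) (e j) = l ord0 i *+ (i == j).
Proof.
transitivity ((P *m kernel_matrix K xs *m P^T) i j); last first.
  by rewrite (diagonalization_conj KPl) mxE.
rewrite rkhs_ip_sumr mxE; apply: eq_bigr => b _.
rewrite rkhs_ipZr rkhs_ip_suml !mxE mulrC; congr (_ * _).
by apply: eq_bigr => a _; rewrite rkhs_ipZl kernel_matrix_gram.
Qed.

(** Sampling f and then applying P gives the inner products of f with the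
    principal vectors, and P preserves the Euclidean norm. *)
Lemma sampled_norm2 f :
  norm2 (fun i => rkhs_fun f (xs i)) =
  Num.sqrt (\sum_j rkhs_ip f (e j) ^+ 2).
Proof.
congr Num.sqrt.
under [RHS]eq_bigr do rewrite principal_ip.
by rewrite (orthogonal_sum_sqr KPl); apply: eq_bigr => i _; rewrite mxE.
Qed.

End sampling_points.
End rkhs_theory.

(** * Stability and residual of spectral regularization *)

(** The approximant is an element w of the RKHS, diagonal in the principal
    vectors: w = sum_j s(l_j) c_j e_j with c_j = <g, e_j>. The bound D on
    t s(t) controls its norm, and the bound B on t^(1/2) (1 - t s(t)) controls
    the sampled residual; Bessel's inequality absorbs the remaining factor
    c_j^2 / l_j. *)
Lemma spectral_filter_bounds (R : realType) (d : nat) (X : set 'rV[R]_d)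
    (K : 'rV[R]_d -> 'rV[R]_d -> R) (H : rkhs X K) (n : nat)
    (xs : 'I_n -> 'rV[R]_d) (reg : R -> R -> R) (lambda D B : R) (g : H) :
  (forall i, X (xs i)) -> 0 <= D -> 0 <= B ->
  (forall t, 0 <= t <= spectral_norm (kernel_matrix K xs) ->
    `|t * reg lambda t| <= D) ->
  (forall t, 0 <= t <= spectral_norm (kernel_matrix K xs) ->
    `|Num.sqrt t * (1 - t * reg lambda t)| <= B) ->
  exists w : H, [/\ forall x, X x -> rkhs_fun w x =
      reg_approx K xs reg lambda (fun i => rkhs_fun g (xs i)) x,
    `|w| <= D * `|g| &
    norm2 (fun i => rkhs_fun (g - w) (xs i)) <= B * `|g|].
Proof.
move=> xs_X D_ge0 B_ge0 fD fB.
have [k k_fun k_ip] := rkhs_representers H xs_X.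
have [P [l [KPl calcE]]] :=
  spectral_calculusP (reg lambda) (kernel_matrix_sym xs_X k_fun k_ip).
pose e (j : 'I_n) : H := \sum_i P j i *: k i.
have e_orth i j : rkhs_ip (e i) (e j) = l ord0 i *+ (i == j).
  exact: (principal_orth xs_X k_fun k_ip KPl).
have l_ge0 j : 0 <= l ord0 j by exact: (orthogonal_sqnorm_ge0 e_orth).
have l_I j : 0 <= l ord0 j <= spectral_norm (kernel_matrix K xs).
  by rewrite l_ge0 (le_trans (ler_norm _))// (eigenvalue_le_spectral_norm KPl).
pose c j := rkhs_ip g (e j); pose r j := reg lambda (l ord0 j).
pose w := \sum_j (r j * c j) *: e j.
exists w; split.
- move=> x Xx.
  (* Exchanging the two sums exhibits the coefficients of w on the k_i. *)
  have -> : w = \sum_i (\sum_j r j * c j * P j i) *: k i.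
    under [RHS]eq_bigr do rewrite scaler_suml.
    rewrite exchange_big/=; apply: eq_bigr => j _; rewrite scaler_sumr.
    by apply: eq_bigr => i _; rewrite scalerA.
  rewrite rkhs_fun_sum//; apply: eq_bigr => i _; rewrite k_fun//.
  congr (_ * _); rewrite /reg_coef calcE -!mulmxA mxE.
  apply: eq_bigr => j _; rewrite mul_diag_mx !mxE mulrC; congr (_ * (_ * _)).
  by rewrite /c (principal_ip k_ip) mxE.
- rewrite -(@ler_pXn2r _ 2) ?nnegrE ?mulr_ge0// exprMn.
  rewrite (orthogonal_comb_sqnorm e_orth).
  apply: le_trans (ler_wpM2l (sqr_ge0 D) (bessel e_orth g)).
  rewrite mulr_sumr ler_sum// => j _.
  have -> : (r j * c j) ^+ 2 * l ord0 j =
      (l ord0 j * r j) ^+ 2 * (c j ^+ 2 / l ord0 j).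
    have [->|lj_neq0] := eqVneq (l ord0 j) 0; last by field.
    by rewrite invr0 !mulr0.
  rewrite ler_wpM2r ?divr_ge0 ?sqr_ge0//.
  by rewrite -[_ ^+ 2]real_normK ?num_real// lerXn2r ?nnegrE ?fD.
- rewrite (sampled_norm2 k_ip KPl) -[leRHS]ger0_norm ?mulr_ge0// -sqrtr_sqr.
  rewrite ler_wsqrtr// exprMn.
  apply: le_trans (ler_wpM2l (sqr_ge0 B) (bessel e_orth g)).
  rewrite mulr_sumr ler_sum// => j _; rewrite -/(e j).
  have -> : rkhs_ip (g - w) (e j) = c j * (1 - l ord0 j * r j).
    by rewrite rkhs_ipBl (orthogonal_comb_ip e_orth) -/(c j); ring.
  have -> : (c j * (1 - l ord0 j * r j)) ^+ 2 =
      (Num.sqrt (l ord0 j) * (1 - l ord0 j * r j)) ^+ 2 *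
      (c j ^+ 2 / l ord0 j).
    rewrite !exprMn sqr_sqrtr//.
    have [lj0|lj_neq0] := eqVneq (l ord0 j) 0; last by field.
    by rewrite /c (orthogonal_null_coef e_orth)// expr0n/= !(mul0r, mulr0).
  rewrite ler_wpM2r ?divr_ge0 ?sqr_ge0//.
  by rewrite -[_ ^+ 2]real_normK ?num_real// lerXn2r ?nnegrE ?fB.
Qed.

(** * Sobolev seminorms *)

Section sobolev_theory.
Variables (R : realType) (d : nat).
Implicit Types (X Omega : set 'rV[R]_d) (u v : 'rV[R]_d -> R).

(** An element of the RKHS and the corresponding kernel expansion agree on X
    only; the extensionality lemmas below let one replace the other. *)
Lemma locally_integrable_ext Omega u v : {in Omega, u =1 v} ->
  Defs.locally_integrable Omega u -> Defs.locally_integrable Omega v.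
Proof.
move=> uv iu A cA AO; have /integrableP[mu iuA] := iu A cA AO.
have uvA : {in A, EFin \o u =1 EFin \o v}.
  by move=> x /set_mem/AO/mem_set/uv /= ->.
apply/integrableP; split; first exact: eq_measurable_fun mu.
by under eq_integral do rewrite -uvA//.
Qed.

Lemma weak_derivatives_ext Omega k (alpha : multi_index d k) u v :
  {in Omega, u =1 v} ->
  weak_derivatives Omega alpha u = weak_derivatives Omega alpha v.
Proof.
move=> uv; rewrite eqEsubset; split=> w [iu iw wE]; split => //.
- exact: locally_integrable_ext iu.
- move=> phi /wE <-; apply: eq_Rintegral => x Ox; by rewrite uv.
- by apply: locally_integrable_ext iu => x Ox; rewrite uv.
- move=> phi /wE <-; apply: eq_Rintegral => x Ox; by rewrite uv.
Qed.

Lemma at_weak_derivative_ext Omega k (alpha : multi_index d k) u v F :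
  {in Omega, u =1 v} ->
  at_weak_derivative Omega alpha u F = at_weak_derivative Omega alpha v F.
Proof.
by move=> uv; rewrite /at_weak_derivative (weak_derivatives_ext alpha uv).
Qed.

Lemma sobolev_seminorm_ext X (p : \bar R) (t : R) u v : {in X, u =1 v} ->
  sobolev_seminorm X p t u = sobolev_seminorm X p t v.
Proof.
move=> uvX; have uv : {in (X° : set 'rV[R]_d), u =1 v}.
  by move=> x /set_mem/interior_subset/mem_set/uvX.
rewrite /sobolev_seminorm /int_seminorm /frac_seminorm.
by case: ifP => _; congr lp_sum; apply/funext => alpha;
  exact: at_weak_derivative_ext.
Qed.

Local Open Scope ereal_scope.

Lemma lp_sum_ge0 (I : finType) (P : pred I) (r : R) (a : I -> \bar R) :
  0 <= lp_sum P r%:E a.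
Proof. exact: poweR_ge0. Qed.

Lemma le_lp_sum (I : finType) (P Q : pred I) (r : R) (a : I -> \bar R) :
  (0 <= r)%R -> subpred P Q -> lp_sum P r%:E a <= lp_sum Q r%:E a.
Proof.
move=> r_ge0 PQ; apply: gt0_ler_poweR; rewrite ?invr_ge0//.
- by rewrite in_itv/= leey andbT sume_ge0// => i _; exact: poweR_ge0.
- by rewrite in_itv/= leey andbT sume_ge0// => i _; exact: poweR_ge0.
rewrite big_mkcond [leRHS]big_mkcond; apply: lee_sum => i _.
by case: ifPn => [/PQ ->//|_]; case: ifP => // _; exact: poweR_ge0.
Qed.

Lemma le_lp_sum_term (I : finType) (i : I) (r : R) (a : I -> \bar R) :
  (0 < r)%R -> 0 <= a i -> a i <= lp_sum predT r%:E a.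
Proof.
move=> r_gt0 ai_ge0.
apply: (@le_trans _ _ (lp_sum (pred1 i) r%:E a)).
  by rewrite /lp_sum big_pred1_eq -poweRrM divff ?gt_eqF// poweRe1.
by apply: le_lp_sum; rewrite ?ltW.
Qed.

Lemma sobolev_seminorm_le_norm X (r t : R) u : (0 < r)%R ->
  sobolev_seminorm X r%:E t u <= sobolev_norm X r%:E t u.
Proof.
move=> r_gt0; rewrite /sobolev_seminorm /sobolev_norm; case: ifP => _.
  by apply: le_lp_sum => [|alpha /eqP ->]; rewrite ?ltW.
by apply: (le_lp_sum_term (i := false)) => //; exact: lp_sum_ge0.
Qed.

End sobolev_theory.

(** * Exponents *)

Lemma fine_inv_maxe2 (R : realType) (q : \bar R) : (1 <= q)%E ->
  fine (maxe 2%:E q)^-1%E = 2^-1 - Num.max (2^-1 - fine (q^-1)%E) 0.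
Proof.
case: q => [q| |]//=.
- rewrite lee_fin => q_ge1; have q_gt0 : 0 < q by lra.
  rewrite -EFin_max !inver !gt_eqF//= ?lt_max ?ltr0n//.
  case: (leP 2 q) => q2.
    have /max_l -> : 0 <= 2^-1 - q^-1 by rewrite subr_ge0 lef_pV2// posrE.
    by rewrite opprB addrC subrK.
  have /max_r -> : 2^-1 - q^-1 <= 0.
    by rewrite subr_le0 lef_pV2 ?posrE// ltW.
  by rewrite subr0.
- move=> _; rewrite maxey invey/= subr0 max_l ?invr_ge0//.
  by rewrite subrr.
Qed.

(** * The error estimate *)

Unset Implicit Arguments.
Set Strict Implicit.

Theorem proposition1 (R : realType) (d : nat) (X : set 'rV[R]_d)
    (X_bounded : bounded_set X) (X_cone : interior_cone X)
    (k : nat) (k_gt0 : (0 < k)%N) (s : R) (s_gt0 : 0 < s)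
    (tau : R) (tauE : tau = k%:R + s) (tau_gt : d%:R / 2 < tau)
    (q : \bar R) (q_ge1 : (1 <= q)%E)
    (excess : R) (excessE : excess = d%:R * Num.max (2^-1 - fine (q^-1)%E) 0)
    (m : nat) (m_le : m%:Z <= Num.ceil (tau - excess) - 1)
    (gamma : \bar R) (gammaE : gamma = maxe 2%:E q)
    (C h0 : R) (C_gt0 : 0 < C) (h0_gt0 : 0 < h0)
    (sampling : forall (n : nat) (xs : 'I_n -> 'rV[R]_d), injective xs ->
      (forall i, X (xs i)) -> (fill_distance X xs <= h0%:E)%E ->
      let h := fine (fill_distance X xs) in
      forall z, continuous_sobolev X 2%:E tau z ->
      (sobolev_seminorm X q m%:R z <=
        C%:E * ((h `^ (tau - m%:R - excess))%:E * sobolev_seminorm X 2%:E tau z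
                + (h `^ (d%:R * fine (gamma^-1)%E - m%:R)
                   * norm2 (fun i => z (xs i)))%:E))%E)
    (K : 'rV[R]_d -> 'rV[R]_d -> R) (H : rkhs X K)
    (Ce : R) (Ce_gt0 : 0 < Ce)
    (embedding : forall f : H,
      continuous_sobolev X 2%:E tau (rkhs_fun f) /\
      (sobolev_norm X 2%:E tau (rkhs_fun f) <= (Ce * `|f|)%:E)%E)
    (n : nat) (xs : 'I_n -> 'rV[R]_d) (xs_inj : injective xs)
    (xs_X : forall i, X (xs i)) (xs_fill : (fill_distance X xs <= h0%:E)%E)
    (reg : R -> R -> R) (D E qs : R) (Ca : R -> R) (D_gt0 : 0 < D)
    (qs_ge : 2^-1 <= qs)
    (reg_reg : regularization (spectral_norm (kernel_matrix K xs))
                 reg D E qs Ca)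
    (g : H) (lambda : R) (lambda_gt0 : 0 < lambda) :
  let h := fine (fill_distance X xs) in
  let ghat := reg_approx K xs reg lambda (fun i => rkhs_fun g (xs i)) in
  let C' := C * Num.max (Ce * (D + 1)) (Ca 2^-1) in
  (sobolev_seminorm X q m%:R (fun x => (rkhs_fun g x - ghat x)%R) <=
    (C' * h `^ (d%:R * fine (gamma^-1)%E - m%:R)
     * (h `^ (tau - d%:R / 2) + lambda `^ 2^-1) * `|g|)%:E)%E.
Proof.
have [reg_D _ _ Ca_gt0 reg_Ca] := reg_reg.
have half_qs : 0 <= (2^-1 : R) <= qs by rewrite qs_ge invr_ge0 ler0n.
have B_ge0 : 0 <= Ca 2^-1 * lambda `^ 2^-1.
  by rewrite mulr_ge0 ?powR_ge0// ltW// Ca_gt0.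
cbv zeta; set h := fine _; set ghat := reg_approx _ _ _ _ _.
(* B = C_{1/2} lambda^(1/2), from the qualification at exponent 1/2. *)
have [t|t|w [wE w_le z_le]] := spectral_filter_bounds
  (reg := reg) (lambda := lambda) g xs_X (ltW D_gt0) B_ge0.
- exact: reg_D lambda_gt0.
- move=> t_I; rewrite -powR12_sqrt; last by case/andP: t_I.
  exact: reg_Ca half_qs lambda_gt0 t_I.
pose f := g - w; pose z := rkhs_fun f.
have zE : {in X, (fun x => rkhs_fun g x - ghat x) =1 z}.
  by move=> x /set_mem Xx; rewrite /z rkhs_funB// wE.
have f_le : `|f| <= (D + 1) * `|g|.
  by rewrite (le_trans (ler_normB _ _))// mulrDl mul1r addrC lerD2r.
have [z_sob z_norm] := embedding f.
have z_semi : (sobolev_seminorm X 2%:E tau z <= (Ce * (D + 1) * `|g|)%:E)%E.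
  apply: le_trans (sobolev_seminorm_le_norm _ _ _ _) _; first exact: ltr0n.
  apply: (le_trans z_norm); rewrite lee_fin -mulrA ler_wpM2l//.
  exact: ltW.
have excess_gamma : d%:R * fine (gamma^-1)%E = d%:R / 2 - excess.
  by rewrite gammaE fine_inv_maxe2// excessE mulrBr.
have m_lt : m%:R < tau - excess.
  rewrite (le_lt_trans _ (ceilB1_lt _))// -[m%:R]/(m%:Z%:~R : R).
  by rewrite ler_int.
rewrite (sobolev_seminorm_ext _ _ zE).
apply: (le_trans (sampling n xs xs_inj xs_X xs_fill z z_sob)).
rewrite -/h; set p := d%:R * _ - m%:R.
(* The power law holds even at h = 0, the exponent on the left being nonzero. *)
have h_split : h `^ (tau - m%:R - excess) = h `^ p * h `^ (tau - d%:R / 2).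
  have pE : tau - m%:R - excess = p + (tau - d%:R / 2).
    by rewrite /p excess_gamma; ring.
  have pD_neq0 : p + (tau - d%:R / 2) != 0 by rewrite -pE gt_eqF//; lra.
  by rewrite pE; apply: powRD; rewrite (negbTE pD_neq0).
set M := Num.max _ _.
have M1 : Ce * (D + 1) <= M by rewrite le_max lexx.
have M2 : Ca 2^-1 <= M by rewrite le_max lexx orbT.
apply: (@le_trans _ _ (C%:E * ((h `^ (tau - m%:R - excess))%:E *
    (Ce * (D + 1) * `|g|)%:E + (h `^ p * norm2 (fun i => z (xs i)))%:E))%E).
  apply: lee_wpmul2l; first by rewrite lee_fin ltW.
  by apply/leeD2r/lee_wpmul2l => //; rewrite lee_fin powR_ge0.
rewrite -[leLHS]/((C * (h `^ (tau - m%:R - excess) * (Ce * (D + 1) * `|g|) +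
  h `^ p * norm2 (fun i => z (xs i))))%:E) lee_fin -!mulrA.
apply: ler_wpM2l; first exact: ltW.
have g_ge0 : 0 <= `|g| by [].
rewrite [leRHS](_ : _ = h `^ p * h `^ (tau - d%:R / 2) * (M * `|g|) +
  h `^ p * (M * lambda `^ 2^-1 * `|g|)); last by ring.
apply: lerD.
  rewrite h_split; apply: ler_wpM2l; first by rewrite mulr_ge0 ?powR_ge0.
  by rewrite mulrA ler_wpM2r.
rewrite ler_wpM2l ?powR_ge0// (le_trans z_le)// ler_wpM2r// ler_wpM2r//.
exact: powR_ge0.
Qed.
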